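(* The pair of maps $R\mapsto \mathrm{spec}^{\sharp}R$ (on objects) and $f\mapsto f^{\sharp}$ (on morphisms), where for a left commutative rng homomorphism $f:R\to S$ one sets $f^{\sharp}:\mathrm{spec}^{\sharp}S\to\mathrm{spec}^{\sharp}R$, $f^{\sharp}(P):=f^{-1}(P)$, defines a contravariant functor from the category of left commutative rngs (with left commutative rng homomorphisms as morphisms) into the category of topological spaces (with continuous maps as morphisms).
   Context: A rng is an associative ring not assumed to have an identity; ''ring'' means a ring with identity. A left commutative rng $(R,+,\cdot,\sharp)$ is a rng $(R,+,\cdot)$ such that: (i) $xyz=yxz$ for all $x,y,z\in R$; (ii) there is a left identity $1^{\ell}\in R$, i.e. $1^{\ell}x=x$ for all $x\in R$; (iii) on the additive halo $\hbar^+(R):=\{x\in R : x1^{\ell}=0\}$ (which does not depend on the choice of left identity) there is given a binary operation $\sharp$, the local product, such that $(\hbar^+(R),+,\sharp)$ is a commutative ring with an identity $1^{\sharp}$, the local identity; (iv) $(x\alpha)\,\sharp\,\beta=x(\alpha\,\sharp\,\beta)$ for all $\alpha,\beta\in\hbar^+(R)$, $x\in R$. The bar-unit set of $R$ is $\hbar^{\times}(R):=\{b\in R : bx=x \text{ for all } x\in R\}$. A left commutative rng homomorphism $\phi:R\to \bar R$ between left commutative rngs with local identities $1^{\sharp}$ and $\bar 1^{\sharp}$ is a map satisfying $\phi(x+y)=\phi(x)+\phi(y)$, $\phi(xy)=\phi(x)\phi(y)$ for $x,y\in R$; $\phi(\hbar^{\times}(R))\cap\hbar^{\times}(\bar R)\neq\emptyset$;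 $\phi(\alpha\,\sharp\,\beta)=\phi(\alpha)\,\sharp\,\phi(\beta)$ for $\alpha,\beta\in\hbar^+(R)$; and $\phi(1^{\sharp})=\bar 1^{\sharp}$. (The first three conditions imply $\phi(\hbar^+(R))\subseteq\hbar^+(\bar R)$, so the fourth makes sense.) An ideal of $R$ is an additive subgroup $I$ with $RI\subseteq I$, $IR\subseteq I$ and $I\cap\hbar^+(R)$ an ideal of the ring $(\hbar^+(R),+,\sharp)$. A Hu-Liu prime ideal of $R$ is an ideal $P\neq R$ such that: (i) for $x,y\in R$, $xy\in P+\hbar^+(R)$ implies $x\in P+\hbar^+(R)$ or $y\in P+\hbar^+(R)$; (ii) for $x,y\in R$, $xy\in P$ implies $x\in P+\hbar^+(R)$ or $y\in P$; (iii) $P\supseteq\hbar^+(R)$, or $P\cap\hbar^+(R)$ is a prime ideal of the commutative ring $(\hbar^+(R),+,\sharp)$. The set of all Hu-Liu prime ideals of $R$ is denoted $\mathrm{spec}^{\sharp}R$. The expanded Zariski topology on $\mathrm{spec}^{\sharp}R$ is the topology whose closed sets are exactly the sets $\mathcal V(I):=\{P\in\mathrm{spec}^{\sharp}R : P\supseteq I\}$, $I$ an ideal of $R$. All spectra carry this topology. *)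

(* Defs.v *)
From HB Require Import structures.
From mathcomp Require Import all_boot all_algebra.
From mathcomp Require Import all_classical topology_structure.

Set Implicit Arguments.
Unset Strict Implicit.
Unset Printing Implicit Defensive.

Import GRing.Theory.
Local Open Scope classical_set_scope.
Local Open Scope ring_scope.

Reserved Notation "x ** y" (at level 40, left associativity).
Reserved Notation "a \# b" (at level 40, left associativity).

(* The part of the structure that does not involve the local product; the
   additive halo is defined at this level. The left identity is only required
   to exist: it is not unique and is not part of the data. *)
HB.mixin Record Zmodule_isPreLcrng R of GRing.Zmodule R := {
  rmul : R -> R -> R;
  rmulA : associative rmul;
  rmulDl : left_distributive rmul +%R;
  rmulDr : right_distributive rmul +%R;
  rmul_lcomm : forall x y z : R, rmul (rmul x y) z = rmul (rmul y x) z;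
  left_id_ex : exists e : R, left_id e rmul
}.

#[short(type="preLcrngType")]
HB.structure Definition PreLcrng := {R of Zmodule_isPreLcrng R & GRing.Zmodule R}.

Notation "x ** y" := (rmul x y) : ring_scope.

Section PreLcrngTheory.
Variable R : preLcrngType.
Implicit Types x y e : R.

Definition bar_units : set R := [set b | forall x, b ** x = x].

Lemma bar_units_nonempty : bar_units !=set0.
Proof. exact: left_id_ex. Qed.

Lemma rmul0 x : x ** 0 = 0.
Proof. by apply: (addrI (x ** 0)); rewrite -rmulDr !addr0. Qed.

Lemma rmul0l x : 0 ** x = 0.
Proof. by apply: (addrI (0 ** x)); rewrite -rmulDl !addr0. Qed.

Lemma rmulNl x y : (- x) ** y = - (x ** y).
Proof. by apply: (addrI (x ** y)); rewrite -rmulDl !subrr rmul0l. Qed.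

Lemma rmulNr x y : x ** (- y) = - (x ** y).
Proof. by apply: (addrI (x ** y)); rewrite -rmulDr !subrr rmul0. Qed.

Definition halo : set R := [set x | exists2 e, bar_units e & x ** e = 0].

Lemma haloP e x : bar_units e -> halo x <-> x ** e = 0.
Proof.
move=> he; split=> [[e' he' xe0]|xe0]; last by exists e.
by rewrite -(he' e) rmulA xe0 rmul0l.
Qed.

Lemma halo_mull x y : halo y -> halo (x ** y).
Proof. by case=> e he ye0; exists e => //; rewrite -rmulA ye0 rmul0. Qed.

Lemma halo_zmod_closed : zmod_closed (fun x => x \in halo).
Proof.
have [e he] := bar_units_nonempty.
split; first by apply/mem_set; exists e => //; rewrite rmul0l.
move=> x y /set_mem /(haloP _ he) x0 /set_mem /(haloP _ he) y0.
by apply/mem_set; exists e => //; rewrite rmulDl rmulNl x0 y0 subr0.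
Qed.

Record halo_type := HaloElt {halo_val :> R; halo_valP : halo_val \in halo}.

HB.instance Definition _ := [isSub for halo_val].
HB.instance Definition _ := [Choice of halo_type by <:].
HB.instance Definition _ :=
  GRing.SubChoice_isSubZmodule.Build R (fun x => x \in halo) halo_type
    halo_zmod_closed.

Lemma halo_valE (a : halo_type) : halo (halo_val a).
Proof. exact: set_mem (halo_valP a). Qed.

Definition halo_elt x (hx : halo x) : halo_type := HaloElt (mem_set hx).

Definition halo_act x (a : halo_type) : halo_type :=
  halo_elt (halo_mull x (halo_valE a)).

End PreLcrngTheory.
Arguments bar_units R : clear implicits.
Arguments halo R : clear implicits.
Arguments halo_type R : clear implicits.

(* The identity of a ring being unique, the local identity may be given as
   part of the data. The zero ring is allowed as (halo, +, #): an ordinary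
   commutative ring has zero halo. *)
HB.mixin Record PreLcrng_isLcrng R of PreLcrng R := {
  local_mul : halo_type R -> halo_type R -> halo_type R;
  local_one : halo_type R;
  local_mulA : associative local_mul;
  local_mulC : commutative local_mul;
  local_mul1 : left_id local_one local_mul;
  local_mulDl : left_distributive local_mul +%R;
  local_mul_act : forall (x : R) (a b : halo_type R),
    local_mul (halo_act x a) b = halo_act x (local_mul a b)
}.

#[short(type="lcrngType")]
HB.structure Definition Lcrng := {R of PreLcrng_isLcrng R & PreLcrng R}.

Notation "a \# b" := (local_mul a b) : ring_scope.

HB.instance Definition _ (R : lcrngType) :=
  GRing.Zmodule_isComPzRing.Build (halo_type R)
    (@local_mulA R) (@local_mulC R) (@local_mul1 R) (@local_mulDl R).

Record is_prehom (R S : preLcrngType) (f : R -> S) : Prop := {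
  prehomD : {morph f : x y / x + y};
  prehomM : {morph f : x y / x ** y};
  prehomU : f @` bar_units R `&` bar_units S !=set0
}.

Lemma prehom_halo (R S : preLcrngType) (f : R -> S) :
  is_prehom f -> forall x, halo R x -> halo S (f x).
Proof.
move=> [fD fM [_ [[b hb <-] hfb]]] x /(haloP _ hb) xb0.
apply/(haloP _ hfb); rewrite -fM xb0.
by apply: (addrI (f 0)); rewrite -fD !addr0.
Qed.

Definition halo_map (R S : preLcrngType) (f : R -> S) (hf : is_prehom f)
    (a : halo_type R) : halo_type S :=
  halo_elt (prehom_halo hf (halo_valE a)).

Record lcrng_hom (R S : lcrngType) := LcrngHom {
  lcrng_fun :> R -> S;
  lcrng_prehom : is_prehom lcrng_fun;
  lcrng_homM : {morph halo_map lcrng_prehom : a b / a \# b};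
  lcrng_hom1 : halo_map lcrng_prehom local_one = local_one
}.

Lemma lcrng_hom_eq (R S : lcrngType) (f g : lcrng_hom R S) : f =1 g -> f = g.
Proof.
case: f g => f pf mf uf [g pg mg ug] /= /funext efg.
subst g; have epq : pf = pg by exact: Prop_irrelevance.
by subst pg; congr LcrngHom; exact: Prop_irrelevance.
Qed.

Lemma prehom_id (R : preLcrngType) : is_prehom (@idfun R).
Proof.
split=> //; have [e he] := bar_units_nonempty R.
by exists e; split=> //; exists e.
Qed.

Lemma prehom_comp (R S T : preLcrngType) (g : S -> T) (f : R -> S) :
  is_prehom g -> is_prehom f -> is_prehom (g \o f).
Proof.
move=> [gD gM [_ [[c hc <-] hgc]]] [fD fM [_ [[b hb <-] hfb]]]; split.
- by move=> x y /=; rewrite fD gD.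
- by move=> x y /=; rewrite fM gM.
exists (g (f b)); split; first by exists b.
by move=> y; rewrite -[in LHS](hgc y) rmulA -gM hfb hgc.
Qed.

Lemma halo_eq (R : preLcrngType) (a b : halo_type R) :
  halo_val a = halo_val b -> a = b.
Proof. exact: val_inj. Qed.

Section HomCategory.

Lemma lcrng_id_homM (R : lcrngType) :
  {morph halo_map (prehom_id R) : a b / a \# b}.
Proof.
have E a : halo_map (prehom_id R) a = a by exact: halo_eq.
by move=> a b; rewrite !E.
Qed.

Lemma lcrng_id_hom1 (R : lcrngType) :
  halo_map (prehom_id R) local_one = local_one.
Proof. exact: halo_eq. Qed.

Definition lcrng_id (R : lcrngType) : lcrng_hom R R :=
  LcrngHom (@lcrng_id_homM R) (@lcrng_id_hom1 R).

Variables (R S T : lcrngType) (g : lcrng_hom S T) (f : lcrng_hom R S).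

Let gf := prehom_comp (lcrng_prehom g) (lcrng_prehom f).

Lemma halo_map_comp a :
  halo_map gf a = halo_map (lcrng_prehom g) (halo_map (lcrng_prehom f) a).
Proof. exact: halo_eq. Qed.

Lemma lcrng_comp_homM : {morph halo_map gf : a b / a \# b}.
Proof. by move=> a b; rewrite !halo_map_comp !lcrng_homM. Qed.

Lemma lcrng_comp_hom1 : halo_map gf local_one = local_one.
Proof. by rewrite halo_map_comp !lcrng_hom1. Qed.

Definition lcrng_comp : lcrng_hom R T := LcrngHom lcrng_comp_homM lcrng_comp_hom1.

End HomCategory.

Record is_ring_ideal (A : comPzRingType) (J : set A) : Prop := {
  ring_ideal0 : J 0;
  ring_idealB : forall x y, J x -> J y -> J (x - y);
  ring_idealM : forall a x, J x -> J (a * x)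
}.

Record is_ring_prime (A : comPzRingType) (J : set A) : Prop := {
  ring_prime_ideal : is_ring_ideal J;
  ring_prime_proper : J <> setT;
  ring_primeM : forall a b, J (a * b) -> J a \/ J b
}.

Section Ideals.
Variable R : lcrngType.
Implicit Types I J P : set R.

(* The intersection with the halo, as a subset of the ring (halo, +, #). *)
Definition halo_trace I : set (halo_type R) := [set a | I (halo_val a)].

Record is_ideal I : Prop := {
  ideal0 : I 0;
  idealB : forall x y, I x -> I y -> I (x - y);
  idealMl : forall r x, I x -> I (r ** x);
  idealMr : forall r x, I x -> I (x ** r);
  ideal_halo : is_ring_ideal (halo_trace I)
}.

Definition add_halo P : set R := [set x + y | x in P & y in halo R].

Record is_hu_liu_prime P : Prop := {
  hlp_ideal : is_ideal P;
  hlp_proper : P <> setT;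
  hlp_halo : forall x y, add_halo P (x ** y) -> add_halo P x \/ add_halo P y;
  hlp_mul : forall x y, P (x ** y) -> add_halo P x \/ P y;
  hlp_local : halo R `<=` P \/ is_ring_prime (halo_trace P)
}.

Record spec := SpecPoint {spec_set :> set R; specP : is_hu_liu_prime spec_set}.

HB.instance Definition _ := gen_eqMixin spec.
HB.instance Definition _ := gen_choiceMixin spec.

Definition zvariety I : set spec := [set P | I `<=` spec_set P].

Definition zclosed : set (set spec) := [set zvariety I | I in is_ideal].

Lemma bigcap_ideal (K : Type) (D : set K) (F : K -> set R) :
  (forall i, D i -> is_ideal (F i)) -> is_ideal (\bigcap_(i in D) F i).
Proof.
move=> hF; split.
- by move=> i /hF [].
- by move=> x y Fx Fy i Di; have [_ + _ _ _] := hF i Di; apply; [exact: Fx|exact: Fy].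
- by move=> r x Fx i Di; have [_ _ + _ _] := hF i Di; apply; exact: Fx.
- by move=> r x Fx i Di; have [_ _ _ + _] := hF i Di; apply; exact: Fx.
split.
- by move=> i Di; have [_ _ _ _ []] := hF i Di.
- by move=> x y Fx Fy i Di; have [_ _ _ _ [_ + _]] := hF i Di; apply; [exact: Fx|exact: Fy].
- by move=> r x Fx i Di; have [_ _ _ _ [_ _ +]] := hF i Di; apply; exact: Fx.
Qed.

Lemma idealI I J : is_ideal I -> is_ideal J -> is_ideal (I `&` J).
Proof.
by move=> hI hJ; rewrite -bigcap2E; apply: bigcap_ideal => -[|[|i]] _ //=.
Qed.

Lemma hu_liu_prime_capP I J P : is_hu_liu_prime P -> is_ideal I -> is_ideal J ->
  I `&` J `<=` P -> I `<=` P \/ J `<=` P.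
Proof.
move=> hP hI hJ IJP; have [e he] := bar_units_nonempty R.
have [_ _ IMl IMr Ih] := hI; have [_ JB JMl JMr Jh] := hJ.
have [[P0 PB PMl PMr _] _ _ hmul hloc] := hP.
have add_haloP x : add_halo P x -> P (x ** e).
  case=> p Pp [y /(haloP _ he) y0 <-].
  by rewrite rmulDl y0 addr0; exact: PMr.
have PD x y : P x -> P y -> P (x + y).
  by move=> Px Py; rewrite -[y]opprK; apply: (PB) => //; rewrite -sub0r; exact: PB.
(* an element of an ideal K outside P + halo, or a halo element of K not in P *)
have key K x : is_ideal K -> K x -> ~ P x ->
    ~ add_halo P x \/ exists2 a : halo_type R, K (halo_val a) & ~ P (halo_val a).
  move=> [K0 KB KMl KMr _] Kx nPx; have [Px|] := pselect (add_halo P x); last by left.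
  right; have hx : halo R (x - x ** e).
    by apply/(haloP _ he); rewrite rmulDl rmulNl -rmulA he subrr.
  exists (halo_elt hx) => /=; first by apply: KB => //; exact: KMr.
  move=> /(PD (x ** e)); rewrite addrC subrK => /(_ (add_haloP _ Px)).
  exact: nPx.
have [IP|nIP] := pselect (I `<=` P); first by left.
have [JP|nJP] := pselect (J `<=` P); first by right.
have /existsNP[x /not_implyP[Ix nPx]] := nIP.
have /existsNP[y /not_implyP[Jy nPy]] := nJP.
exfalso; case: (key I x hI Ix nPx) => [nx|[a Ia na]].
  have /hmul [//|//] : P (x ** y) by apply: IJP; split; [exact: IMr|exact: JMl].
case: (key J y hJ Jy nPy) => [ny|[b Jb nb]].
  have /hmul [//|//] : P (y ** x) by apply: IJP; split; [exact: IMl|exact: JMr].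
case: hloc => [hlP|[_ _ hprime]]; first exact: na (hlP _ (halo_valE a)).
have : halo_trace P (a * b).
  apply: IJP; split; last by case: Jh => _ _; apply.
  by rewrite mulrC; case: Ih => _ _; apply.
by case/hprime.
Qed.

Lemma zclosedU (A B : set spec) : zclosed A -> zclosed B -> zclosed (A `|` B).
Proof.
move=> [I hI <-] [J hJ <-]; exists (I `&` J); first exact: idealI.
apply/seteqP; split=> [P /(hu_liu_prime_capP (specP P) hI hJ)//|P].
by case=> IP x [Ix Jx]; exact: IP.
Qed.

Lemma zclosed_bigcap (K : Type) (F : K -> set spec) :
  (forall i, zclosed (F i)) -> zclosed (\bigcap_i F i).
Proof.
move=> hF; pose D := [set L : set R | is_ideal L /\
  forall i I, is_ideal I -> zvariety I = F i -> I `<=` L].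
exists (\bigcap_(L in D) L); first by apply: bigcap_ideal => L [].
apply/seteqP; split=> [P DP i _|P FP x Dx].
  have [I hI IF] := hF i; rewrite -IF => x Ix; apply: DP => L [_ hL].
  exact: hL hI IF _ Ix.
apply: (Dx (spec_set P)); split; first by case: (specP P).
by move=> i I hI IF; move: (FP i Logic.I); rewrite -IF.
Qed.

Lemma zclosed0 : zclosed set0.
Proof.
exists setT; first by split=> //; split.
apply/seteqP; split=> // P TP; have [_ + _ _ _] := specP P.
by apply; apply/seteqP; split.
Qed.

Lemma zclosedT : zclosed setT.
Proof.
exists (\bigcap_(L in is_ideal) L); first exact: bigcap_ideal.
apply/seteqP; split=> // P _ x Dx; apply: (Dx (spec_set P)); by case: (specP P).
Qed.

Definition zopen : set (set spec) := [set U | zclosed (~` U)].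

Lemma zopenT : zopen setT.
Proof. by rewrite /zopen /= setCT; exact: zclosed0. Qed.

Lemma zopenI : setI_closed zopen.
Proof. by move=> U V hU hV; rewrite /zopen /= setCI; exact: zclosedU. Qed.

Lemma zopen_bigU (K : Type) (F : K -> set spec) :
  (forall i, zopen (F i)) -> zopen (\bigcup_i F i).
Proof. by move=> hF; rewrite /zopen /= setC_bigcup; exact: zclosed_bigcap. Qed.

HB.instance Definition _ := isOpenTopological.Build spec zopenT zopenI zopen_bigU.

Lemma zariski_closedE : [set A : set spec | closed A] = zclosed.
Proof.
apply/seteqP; split=> A /=; rewrite -openC.
  by rewrite -[A in zclosed A]setCK.
by move=> hA; rewrite /open /= /zopen /= setCK.
Qed.

End Ideals.
Arguments spec R : clear implicits.

Record category := Category {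
  ob :> Type;
  mor : ob -> ob -> Type;
  cat_id : forall a, mor a a;
  cat_comp : forall x y z, mor y z -> mor x y -> mor x z;
  cat_comp1f : forall a b (f : mor a b), cat_comp (cat_id b) f = f;
  cat_compf1 : forall a b (f : mor a b), cat_comp f (cat_id a) = f;
  cat_compA : forall a b c d (h : mor c d) (g : mor b c) (f : mor a b),
    cat_comp h (cat_comp g f) = cat_comp (cat_comp h g) f
}.
Arguments cat_id {_} _.
Arguments cat_comp {_ _ _ _}.

Record is_contravariant_functor (C D : category) (F0 : C -> D)
    (F1 : forall a b : C, mor a b -> mor (F0 b) (F0 a)) : Prop := {
  functor_id : forall a : C, F1 a a (cat_id a) = cat_id (F0 a);
  functor_comp : forall (a b c : C) (g : mor b c) (f : mor a b),
    F1 a c (cat_comp g f) = cat_comp (F1 a b f) (F1 b c g)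
}.

Definition LCRng : category.
Proof.
refine (@Category lcrngType lcrng_hom lcrng_id lcrng_comp _ _ _).
- by move=> R S f; exact: lcrng_hom_eq.
- by move=> R S f; exact: lcrng_hom_eq.
- by move=> R S T U h g f; exact: lcrng_hom_eq.
Defined.

Definition Top : category.
Proof.
refine (@Category topologicalType (fun X Y => continuousType X Y)
  (fun X => @idfun X) (fun X Y Z g f => g \o f) _ _ _).
- by move=> X Y f; apply/continuousEP.
- by move=> X Y f; apply/continuousEP.
- by move=> X Y Z T h g f; apply/continuousEP.
Defined.

Definition Spec (R : LCRng) : Top := spec (R : lcrngType).

(* Main.v *)
From HB Require Import structures.
Require Import Defs.
From mathcomp Require Import all_boot all_algebra.
From mathcomp Require Import all_classical topology_structure.

(** A Hu-Liu prime [P] is governed by two conditions modulo [P + halo] and one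
on its trace on the halo, and each of them pulls back along a homomorphism
[f : R -> S].

Membership in [P + halo] looks like an existence statement, which a preimage
need not preserve. But for any left identity [e] the element [x - x ** e] lies
in the halo, and [x |-> x ** e] kills the halo, so [x] belongs to [P + halo]
exactly when [x ** e] belongs to [P] ([add_haloE]). A homomorphism sends some
left identity [b] of [R] to a left identity of [S]; testing with [b] and with
[f b] gives [f @^-1` (P + halo) = f @^-1` P + halo] ([add_halo_preimage]), and
the two multiplicative conditions follow at once. The same [b] shows that the
preimage is proper: an ideal containing the left identity [f b] is everything.
On halos [f] is a homomorphism of commutative rings preserving the local
identity, so the third condition is the classical fact that prime ideals of
commutative rings pull back to prime ideals.

Continuity is the observation that [f @^-1` P] contains [I] if and only if [P]
contains the ideal generated by [f @` I] ([preimage_zvariety]).  Functoriality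
holds because a point of the spectrum is determined by its underlying set and
taking preimages is functorial. *)

Set Implicit Arguments.
Unset Strict Implicit.
Unset Printing Implicit Defensive.

Import GRing.Theory.
Local Open Scope classical_set_scope.
Local Open Scope ring_scope.

(** * Ideals and the sum with the halo *)

(** The right-hand side is first-order in [x], hence compatible with preimages,
unlike the definition of [P + halo]. *)
Lemma add_haloE (R : lcrngType) (P : set R) (e x : R) :
  is_ideal P -> bar_units R e -> add_halo P x <-> P (x ** e).
Proof.
move=> idP he; split=> [[p Pp [y /(haloP _ he) y0 <-]]|Pxe].
  by rewrite rmulDl y0 addr0; exact: (Defs.idealMr idP).
exists (x ** e) => //; exists (x - x ** e); last by rewrite addrC subrK.
by apply/(haloP _ he); rewrite rmulDl rmulNl -rmulA he subrr.
Qed.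

Lemma ideal_bar_unit (R : lcrngType) (P : set R) (e : R) :
  is_ideal P -> bar_units R e -> P e -> P = setT.
Proof.
move=> idP he Pe; apply/seteqP; split=> // x _.
by rewrite -(he x); exact: (Defs.idealMr idP).
Qed.

Lemma ring_ideal_one (A : comPzRingType) (J : set A) :
  is_ring_ideal J -> J 1 -> J = setT.
Proof.
move=> idJ J1; apply/seteqP; split=> // x _.
by rewrite -(mulr1 x); exact: (ring_idealM idJ).
Qed.

Section GeneratedIdeal.
Variables (R : lcrngType) (X : set R).

Definition ideal_gen : set R := \bigcap_(L in [set L | is_ideal L /\ X `<=` L]) L.

Lemma ideal_gen_ideal : is_ideal ideal_gen.
Proof. by apply: bigcap_ideal => L []. Qed.

Lemma ideal_gen_sub (L : set R) : is_ideal L -> ideal_gen `<=` L <-> X `<=` L.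
Proof.
move=> idL; split=> [genL x Xx|XL x]; last exact.
by apply: genL => K [_]; apply.
Qed.

End GeneratedIdeal.

(** * Preimages of ideals and of Hu-Liu primes *)

Section Preimage.
Variables (R S : lcrngType) (f : lcrng_hom R S).

Let fprehom : is_prehom f := lcrng_prehom f.
Let fhalo : halo_type R -> halo_type S := halo_map fprehom.

Lemma lcrng_homB (x y : R) : f (x - y) = f x - f y.
Proof. by apply: (addIr (f y)); rewrite -(prehomD fprehom) !subrK. Qed.

Lemma lcrng_hom0 : f 0 = 0.
Proof. by rewrite -(subrr 0) lcrng_homB subrr. Qed.

Lemma halo_map0 : fhalo 0 = 0.
Proof. by apply: halo_eq; exact: lcrng_hom0. Qed.

Lemma halo_mapB (a b : halo_type R) : fhalo (a - b) = fhalo a - fhalo b.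
Proof. by apply: halo_eq; exact: lcrng_homB. Qed.

Lemma halo_mapM (a b : halo_type R) : fhalo (a * b) = fhalo a * fhalo b.
Proof. exact: lcrng_homM. Qed.

Lemma halo_map1 : fhalo 1 = 1.
Proof. exact: lcrng_hom1. Qed.

Lemma ring_ideal_preimage (J : set (halo_type S)) :
  is_ring_ideal J -> is_ring_ideal (fhalo @^-1` J).
Proof.
move=> idJ; split=> [|a b Ja Jb|c a Ja] /=.
- by rewrite halo_map0; exact: (ring_ideal0 idJ).
- by rewrite halo_mapB; exact: (ring_idealB idJ).
- by rewrite halo_mapM; exact: (ring_idealM idJ).
Qed.

Lemma ring_prime_preimage (J : set (halo_type S)) :
  is_ring_prime J -> is_ring_prime (fhalo @^-1` J).
Proof.
move=> [idJ properJ primeJ]; split=> [|JT|a b /=].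
- exact: ring_ideal_preimage.
- apply/properJ/ring_ideal_one => //.
  by rewrite -halo_map1 -[J _]/((fhalo @^-1` J) 1) JT.
- by rewrite halo_mapM; exact: primeJ.
Qed.

Lemma ideal_preimage (P : set S) : is_ideal P -> is_ideal (f @^-1` P).
Proof.
move=> idP; split=> [|x y Px Py|r x Px|r x Px|] /=.
- by rewrite lcrng_hom0; exact: (Defs.ideal0 idP).
- by rewrite lcrng_homB; exact: (Defs.idealB idP).
- by rewrite (prehomM fprehom); exact: (Defs.idealMl idP).
- by rewrite (prehomM fprehom); exact: (Defs.idealMr idP).
(* The trace of the preimage is the preimage of the trace, by conversion. *)
- exact: ring_ideal_preimage (ideal_halo idP).
Qed.

(** Tests both memberships with a left identity of [R] whose image is a left
identity of [S]. *)
Lemma add_halo_preimage (P : set S) (x : R) :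
  is_ideal P -> add_halo (f @^-1` P) x <-> add_halo P (f x).
Proof.
move=> idP; have [_ [[b hb <-] hfb]] := prehomU fprehom.
rewrite (add_haloE _ (ideal_preimage idP) hb) (add_haloE _ idP hfb).
by rewrite /preimage /= (prehomM fprehom).
Qed.

Lemma hu_liu_prime_preimage (P : set S) :
  is_hu_liu_prime P -> is_hu_liu_prime (f @^-1` P).
Proof.
move=> [idP properP haloP mulP localP].
have haloE x : add_halo (f @^-1` P) x <-> add_halo P (f x).
  exact: add_halo_preimage.
split=> [|PT|x y|x y /=|].
- exact: ideal_preimage.
- have [_ [[b _ <-] hfb]] := prehomU fprehom.
  apply/properP/(ideal_bar_unit idP hfb).
  by rewrite -[P _]/((f @^-1` P) b) PT.
- by rewrite !haloE (prehomM fprehom); exact: haloP.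
- by rewrite haloE (prehomM fprehom); exact: mulP.
- case: localP => [haloPsub|primeP]; [left=> x hx|right].
    by apply: haloPsub; exact: prehom_halo.
  exact: ring_prime_preimage primeP.
Qed.

(** * The induced continuous map of spectra *)

Definition spec_map (P : spec S) : spec R :=
  SpecPoint (hu_liu_prime_preimage (specP P)).

Lemma preimage_zvariety (I : set R) :
  spec_map @^-1` zvariety I = zvariety (ideal_gen (f @` I)).
Proof.
apply/seteqP; split=> P /=; rewrite /zvariety /=.
  move=> IP; apply/(ideal_gen_sub _ (hlp_ideal (specP P))).
  by move=> _ [x Ix <-]; exact: IP.
move/(ideal_gen_sub _ (hlp_ideal (specP P))) => fIP x Ix.
by apply: fIP; exists x.
Qed.

Lemma spec_map_continuous : continuous spec_map.
Proof.
apply/continuous_closedP => A.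
rewrite -[closed A]/([set B : set (spec R) | closed B] A) zariski_closedE.
move=> [I _ <-]; rewrite preimage_zvariety.
rewrite -[closed _]/([set B : set (spec S) | closed B] _) zariski_closedE.
by exists (ideal_gen (f @` I)) => //; exact: ideal_gen_ideal.
Qed.

HB.instance Definition _ :=
  isContinuous.Build (spec S) (spec R) spec_map spec_map_continuous.

End Preimage.

Lemma spec_eq (R : lcrngType) (P Q : spec R) : spec_set P = spec_set Q -> P = Q.
Proof.
case: P Q => P hP [Q hQ] /= PQ; subst Q.
by congr SpecPoint; exact: Prop_irrelevance.
Qed.

Theorem mainTheorem3 :
  exists F : forall R S : LCRng, mor R S -> mor (Spec S) (Spec R),
    (forall (R S : lcrngType) (f : lcrng_hom R S) (P : spec S),
        spec_set ((F R S f : continuousType (spec S) (spec R)) P)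
          = f @^-1` spec_set P) /\
    @is_contravariant_functor LCRng Top Spec F.
Proof.
exists (fun (R S : lcrngType) (f : lcrng_hom R S) =>
  spec_map f : continuousType (spec S) (spec R)).
split=> //; split=> [R|R S T g f]; apply/continuousEP => P; exact: spec_eq.
Qed.
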